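(* Let $a>0$, let $m\ge 3$ be an integer, let $\theta\in[0,1]$, and let $\Delta x=1/m$. Consider the advection equation $U_t=aU_x$ on $x\in[0,1]$, $t>0$, with periodic boundary condition $U(0,t)=U(1,t)$, discretized with second-order centered differences in space on $m$ grid points and with the $\theta$-method in time with step size $\Delta t>0$. The full discretization takes the form $u^{n+1}=Mu^n$ with $$M=(I-\theta\nu L)^{-1}\bigl(I+(1-\theta)\nu L\bigr)\in\mathbb{R}^{m\times m},\qquad \nu=a\frac{\Delta t}{\Delta x}>0,$$ and the following hold. (i) If $m$ is even, then (for every $\Delta t>0$) $M$ has at least one negative entry. (ii) If $m$ is odd and $\theta\in\left[\frac{m-1}{m},1\right]$, then for large enough $\Delta t$ all entries of $M$ are non-negative.
   Context: $L\in\mathbb{R}^{m\times m}$ is the circulant matrix of the second-order centered difference scheme: with indices taken modulo $m$, $L_{i,i+1}=\frac12$, $L_{i,i-1}=-\frac12$ for $1\le i\le m$ (so in particular $L_{1,m}=-\frac12$ and $L_{m,1}=\frac12$), and all other entries are $0$. The spatial semi-discretization is $u'(t)=\frac{a}{\Delta x}Lu(t)$, $u(t)\in\mathbb{R}^m$, and the $\theta$-method applied to it is $u^{n+1}=u^n+\frac{a\Delta t}{\Delta x}\bigl((1-\theta)Lu^n+\theta Lu^{n+1}\bigr)$ (superscripts of $u$ denote time steps). $I$ is the $m\times m$ identity matrix. In (ii), ''large enough $\Delta t$'' is meant for fixed $a$, $m$, $\theta$. *)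

(* Defs.v *)
From mathcomp Require Import all_boot all_order all_algebra.
From mathcomp Require Import reals.

Set Implicit Arguments.
Unset Strict Implicit.
Unset Printing Implicit Defensive.

Import Order.TTheory GRing.Theory Num.Theory.
Local Open Scope ring_scope.

(* Indices are 0-based; [ordS] and [ord_pred] are successor and predecessor
   modulo [m], and they differ from each other at every index when [2 < m]. *)
Definition centered_mx (R : realType) (m : nat) : 'M[R]_m :=
  \matrix_(i, j)
    if j == ordS i then 1 / 2 else if j == ord_pred i then - (1 / 2) else 0.

Definition theta_step (R : realType) (m : nat) (a dx dt theta : R)
    (u v : 'cV[R]_m) : Prop :=
  v = u + (a * dt / dx) *:
        ((1 - theta) *: (centered_mx R m *m u) + theta *: (centered_mx R m *m v)).

Definition mesh_width (R : realType) (m : nat) : R := 1 / m%:R.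

Definition courant (R : realType) (m : nat) (a dt : R) : R :=
  a * (dt / mesh_width R m).

Definition implicit_mx (R : realType) (m : nat) (theta nu : R) : 'M[R]_m :=
  1%:M - (theta * nu) *: centered_mx R m.

Definition explicit_mx (R : realType) (m : nat) (theta nu : R) : 'M[R]_m :=
  1%:M + ((1 - theta) * nu) *: centered_mx R m.

(* [invmx A] is the inverse of [A] only when [A \in unitmx]. *)
Definition iteration_mx (R : realType) (m : nat) (theta nu : R) : 'M[R]_m :=
  invmx (implicit_mx m theta nu) *m explicit_mx m theta nu.

(* Main.v *)
Require Import Defs.
From mathcomp Require Import all_boot all_order all_algebra.
From mathcomp Require Import reals.
From mathcomp Require Import zify ring lra.

Import Order.TTheory GRing.Theory Num.Theory.
Local Open Scope ring_scope.

(** Write [L] for the centered difference matrix, [nu] for the Courant number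
    and [A = 1 - theta nu L], so that [M = A^-1 (1 + (1 - theta) nu L)].
    Everything rests on [L] being skew-symmetric and on its kernel; no
    diagonalization is used.

    Skew-symmetry gives [v A v^T = v v^T], hence [A] is invertible.

    For even [m], the kernel of [L] contains the constant vector and the
    alternating vector [s], with [s_i = (-1)^i], so [M] fixes both.  If [M] were
    nonnegative, row [i] would be a probability distribution for which [s]
    averages to its extreme value [s_i]; so [M] would vanish between indices of
    opposite parity ([nonneg_fix_sign_eq0]).  As [L] couples only indices of
    opposite parity, the even part of the equation [A M = 1 + (1 - theta) nu L]
    would then read [M = 1], which forces [nu L = 0].

    For odd [m], put [N = A^-1].  Then [theta M = N - (1 - theta)], so what is
    needed is that [N] is nonnegative and that its diagonal entries are at least
    [1 - theta].  A column [x = N e_j] has sum [1], because the constant vector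
    is in the kernel of [L^T], and [|x|^2 = x_j], because of the identity for
    [v A v^T].  Hence Cauchy-Schwarz gives [x_j >= 1/m] ([resolvent_diag_ge]),
    and [1/m >= 1 - theta] exactly when [theta >= (m - 1)/m].  Moreover
    [theta nu L x = x - e_j] is bounded independently of [nu], so [x] varies by
    [O(1 / (theta nu))] along steps of two grid points.  Since [m] is odd, such
    steps reach every grid point from [j], and for large [nu] no entry of [x] can
    fall from [1/m] to below [0] ([resolvent_odd_ge0]). *)

(** * Skew-symmetric matrices *)

(** Transposition fixes a 1 by 1 matrix, and turns this one into its opposite. *)
Lemma skew_form_eq0 {R : realFieldType} {n : nat} (A : 'M[R]_n) (v : 'rV[R]_n) :
  A^T = - A -> v *m A *m v^T = 0.
Proof.
move=> skewA; set q := v *m A *m v^T.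
have qT : q^T = - q.
  by rewrite /q !trmx_mul trmxK skewA mulNmx mulmxN mulmxA.
apply/matrixP => i j; rewrite !ord1 mxE.
by have := congr1 (fun B : 'M_1 => B 0 0) qT; rewrite !mxE; lra.
Qed.

Lemma skew_resolvent_form {R : realFieldType} {n : nat} (A : 'M[R]_n) (c : R)
    (v : 'rV[R]_n) :
  A^T = - A -> v *m (1%:M - c *: A) *m v^T = v *m v^T.
Proof.
move=> skewA.
rewrite mulmxBr mulmx1 mulmxBl -scalemxAr -scalemxAl.
by rewrite skew_form_eq0 // scaler0 subr0.
Qed.

Lemma row_sqnormE {R : realFieldType} {n : nat} (v : 'rV[R]_n) :
  (v *m v^T) 0 0 = \sum_j v 0 j ^+ 2.
Proof. by rewrite mxE; apply: eq_bigr => j _; rewrite mxE expr2. Qed.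

(** If [v (1 - c A) = 0], multiplying by [v^T] on the right leaves [v v^T = 0]. *)
Lemma skew_resolvent_unit {R : realFieldType} {n : nat} (A : 'M[R]_n) (c : R) :
  A^T = - A -> 1%:M - c *: A \in unitmx.
Proof.
move=> skewA; rewrite -row_free_unit -kermx_eq0; apply/rowV0P => v.
move/sub_kermxP => vA0; have := skew_resolvent_form A c v skewA.
rewrite vA0 mul0mx => /(congr1 (fun B : 'M_1 => B 0 0)).
rewrite row_sqnormE mxE => /esym/eqP.
rewrite psumr_eq0 => [/allP v0|j _]; last exact: sqr_ge0.
apply/rowP => j; rewrite mxE; apply/eqP; rewrite -sqrf_eq0.
exact: v0 (mem_index_enum j).
Qed.

(** * The centered difference matrix *)

Lemma ordS_neq_pred {m : nat} (i : 'I_m) : (3 <= m)%N -> ordS i != ord_pred i.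
Proof.
move=> m3; rewrite -val_eqE /=; have im := ltn_ord i.
case: (ltngtP i.+1 m) => [lt||eq]; [|lia|].
  rewrite modn_small //; case: (posnP i) => [->|i0].
    by rewrite add0n modn_small; lia.
  have -> : (i + m).-1 = (i.-1 + m)%N by lia.
  by rewrite modnDr modn_small; lia.
rewrite eq modnn.
have -> : (i + m).-1 = (i.-1 + m)%N by lia.
by rewrite modnDr modn_small; lia.
Qed.

Lemma eq_ordS {m : nat} (i j : 'I_m) : (i == ordS j) = (j == ord_pred i).
Proof. by apply/eqP/eqP => ->; rewrite ?ordSK ?ord_predK. Qed.

(** The two branches of the definition never overlap, so the entry is additive
    in them; this is the form in which skew-symmetry and products are read. *)
Lemma centered_mxE {R : realType} {m : nat} (i j : 'I_m) : (3 <= m)%N ->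
  centered_mx R m i j = ((j == ordS i)%:R - (j == ord_pred i)%:R) / 2.
Proof.
move=> m3; rewrite mxE; case: eqP => [->|_].
  by rewrite (negbTE (ordS_neq_pred i m3)) subr0.
by case: eqP => _ /=; lra.
Qed.

Lemma centered_mx_skew {R : realType} {m : nat} : (3 <= m)%N ->
  (centered_mx R m)^T = - centered_mx R m.
Proof.
move=> m3; apply/matrixP => i j; rewrite mxE [RHS]mxE !centered_mxE //.
by rewrite eq_ordS -(eq_ordS j i); lra.
Qed.

Lemma sum_delta {R : pzRingType} {m : nat} (k : 'I_m) (f : 'I_m -> R) :
  \sum_j (j == k)%:R * f j = f k.
Proof.
by rewrite (bigD1 k) //= eqxx mul1r big1 ?addr0 // => j /negbTE ->; rewrite mul0r.
Qed.

Lemma mul_centered_mxE {R : realType} {m p : nat} (B : 'M[R]_(m, p)) i k :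
  (3 <= m)%N ->
  (centered_mx R m *m B) i k = (B (ordS i) k - B (ord_pred i) k) / 2.
Proof.
move=> m3; rewrite mxE.
under eq_bigr => j _ do rewrite centered_mxE // mulrAC mulrBl.
by rewrite -mulr_suml sumrB !sum_delta.
Qed.

Lemma centered_mx_const {R : realType} {m p : nat} (c : R) : (3 <= m)%N ->
  centered_mx R m *m (const_mx c : 'M_(m, p)) = 0.
Proof.
by move=> m3; apply/matrixP => i k; rewrite mul_centered_mxE // !mxE subrr mul0r.
Qed.

Lemma implicit_mx_unit {R : realType} {m : nat} (theta nu : R) : (3 <= m)%N ->
  implicit_mx m theta nu \in unitmx.
Proof. by move=> m3; apply/skew_resolvent_unit/centered_mx_skew. Qed.

Lemma implicit_iteration_mx {R : realType} {m : nat} (theta nu : R) :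
  (3 <= m)%N ->
  implicit_mx m theta nu *m iteration_mx m theta nu = explicit_mx m theta nu.
Proof. by move=> m3; rewrite mulKVmx // implicit_mx_unit. Qed.

Lemma theta_stepP {R : realType} {m : nat} (a dx dt theta : R) (u v : 'cV[R]_m) :
  (3 <= m)%N ->
  theta_step a dx dt theta u v <->
  v = iteration_mx m theta (a * (dt / dx)) *m u.
Proof.
move=> m3; rewrite /theta_step mulrA; set nu := a * dt / dx.
have unitA := implicit_mx_unit theta nu m3.
have -> : v = iteration_mx m theta nu *m u <->
          implicit_mx m theta nu *m v = explicit_mx m theta nu *m u.
  split=> [->|eq]; first by rewrite mulmxA implicit_iteration_mx.
  by rewrite -mulmxA -eq mulKmx.
rewrite mulmxBl mulmxDl !mul1mx -!scalemxAl scalerDr !scalerA addrA.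
rewrite [nu * _]mulrC [nu * theta]mulrC.
by split=> [e|/eqP]; [rewrite {1}e addrK | rewrite subr_eq => /eqP].
Qed.

(** * An even number of grid points *)

Lemma iteration_mx_fix {R : realType} {m p : nat} (theta nu : R)
    (w : 'M[R]_(m, p)) : (3 <= m)%N ->
  centered_mx R m *m w = 0 -> iteration_mx m theta nu *m w = w.
Proof.
move=> m3 Lw0.
rewrite -[RHS](mulKmx (implicit_mx_unit theta nu m3)) -mulmxA.
by rewrite mulmxDl mulmxBl -!scalemxAl Lw0 !scaler0 subr0 addr0.
Qed.

(** Only for even [m] does parity alternate all the way around the cycle: the
    wrap-around step goes from the odd index [m - 1] to [0]. *)
Lemma odd_ordS {m : nat} (i : 'I_m) : ~~ odd m -> odd (ordS i) = ~~ odd i.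
Proof. by move=> /negbTE even_m; rewrite /= odd_mod. Qed.

Lemma odd_ord_pred {m : nat} (i : 'I_m) :
  ~~ odd m -> odd (ord_pred i) = ~~ odd i.
Proof. by move=> even_m; rewrite -[in RHS](ord_predK i) odd_ordS // negbK. Qed.

Definition alternating_col (R : realType) (m : nat) : 'cV[R]_m :=
  \col_i (-1) ^+ odd i.

Lemma centered_mx_alternating {R : realType} {m : nat} :
  (3 <= m)%N -> ~~ odd m -> centered_mx R m *m alternating_col R m = 0.
Proof.
move=> m3 even_m; apply/matrixP => i k.
by rewrite mul_centered_mxE // !mxE odd_ordS // odd_ord_pred // subrr mul0r.
Qed.

(** The sum over [k] of [M i k * (1 - s_i s_k)] is [1 - s_i^2 = 0], and all its
    terms are nonnegative; so each vanishes, and [1 - s_i s_j = 2] when the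
    parities of [i] and [j] differ. *)
Lemma nonneg_fix_sign_eq0 {R : realType} {m : nat} (M : 'M[R]_m) :
  (forall i j, 0 <= M i j) ->
  M *m (const_mx 1 : 'cV_m) = const_mx 1 ->
  M *m alternating_col R m = alternating_col R m ->
  forall i j : 'I_m, odd i != odd j -> M i j = 0.
Proof.
move=> M_ge0 M1 Ms i j neq_ij.
pose s (k : 'I_m) : R := (-1) ^+ odd k.
have s2 k : s k * s k = 1 by rewrite -expr2 sqrr_sign.
have row1 : \sum_k M i k = 1.
  have := congr1 (fun w : 'cV_m => w i 0) M1; rewrite !mxE => <-.
  by apply: eq_bigr => k _; rewrite mxE mulr1.
have rows : \sum_k M i k * s k = s i.
  have := congr1 (fun w : 'cV_m => w i 0) Ms; rewrite !mxE -/(s i) => <-.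
  by apply: eq_bigr => k _; rewrite mxE.
have sum0 : \sum_k M i k * (1 - s i * s k) = 0.
  under eq_bigr => k _ do rewrite mulrBr mulr1 mulrCA.
  by rewrite sumrB -mulr_sumr row1 rows s2 subrr.
have term_ge0 k : 0 <= M i k * (1 - s i * s k).
  apply: mulr_ge0 => //; rewrite /s.
  by case: (odd i); case: (odd k); rewrite ?expr0 ?expr1; lra.
have /eqP := sum0; rewrite psumr_eq0 // => /allP /(_ j (mem_index_enum j)) /=.
rewrite mulf_eq0 => /orP [/eqP //|]; rewrite /s.
by case: (odd i) neq_ij; case: (odd j); rewrite ?expr0 ?expr1 //= => _ /eqP; lra.
Qed.

Lemma iteration_mx_even_neg {R : realType} {m : nat} (theta nu : R) :
  (3 <= m)%N -> ~~ odd m -> nu != 0 ->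
  exists i j : 'I_m, iteration_mx m theta nu i j < 0.
Proof.
move=> m3 even_m nu_neq0; set M := iteration_mx m theta nu.
have [/existsP [i /existsP [j Mij]]|noneg] :=
  boolP [exists i, [exists j, M i j < 0]]; first by exists i, j.
have M_ge0 i j : 0 <= M i j.
  rewrite leNgt; apply: contra noneg => Mij_lt0.
  by apply/existsP; exists i; apply/existsP; exists j.
have opp0 : forall i j : 'I_m, odd i != odd j -> M i j = 0.
  apply: nonneg_fix_sign_eq0 => //; apply: iteration_mx_fix => //.
    exact: centered_mx_const.
  exact: centered_mx_alternating.
have entry i j : M i j - theta * nu * ((M (ordS i) j - M (ord_pred i) j) / 2)
    = (i == j)%:R + (1 - theta) * nu * centered_mx R m i j.
  have := congr1 (fun B : 'M_m => B i j) (implicit_iteration_mx theta nu m3).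
  rewrite /= -/M /implicit_mx /explicit_mx mulmxBl mul1mx -scalemxAl.
  rewrite mxE [X in _ + X]mxE [X in _ - X]mxE mul_centered_mxE //.
  by rewrite [RHS]mxE !mxE => ->.
(* Where [i] and [j] have the same parity, the neighbours of [i] do not, so both
   difference terms of the entry equation vanish. *)
have M1 : M = 1%:M.
  apply/matrixP => i j; rewrite [RHS]mxE.
  have [same|/[dup] neq /opp0 ->] := eqVneq (odd i) (odd j); last first.
    by case: eqP => // eq_ij; rewrite eq_ij eqxx in neq.
  have nextM : M (ordS i) j = 0.
    by rewrite opp0 // odd_ordS // same; case: (odd j).
  have prevM : M (ord_pred i) j = 0.
    by rewrite opp0 // odd_ord_pred // same; case: (odd j).
  have := entry i j; rewrite nextM prevM centered_mxE //.
  rewrite subrr mul0r mulr0 subr0 => ->.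
  have -> : (j == ordS i) = false.
    by apply/eqP => eq_j; move: same; rewrite eq_j odd_ordS //; case: (odd i).
  have -> : (j == ord_pred i) = false.
    by apply/eqP => eq_j; move: same; rewrite eq_j odd_ord_pred //; case: (odd i).
  by rewrite subrr mul0r mulr0 addr0.
pose i0 : 'I_m := Ordinal (leq_trans (isT : 0 < 3)%N m3).
(* With [M = 1], the entry just above the diagonal says that
   [- theta nu / 2 = (1 - theta) nu / 2]. *)
have := entry i0 (ordS i0); rewrite M1 !mxE eqxx.
rewrite [ord_pred _ == _]eq_sym (negbTE (ordS_neq_pred i0 m3)) /= => e.
by case/eqP: nu_neq0; lra.
Qed.

(** * An odd number of grid points *)

Lemma iter_ordS2E {m : nat} k (i : 'I_m) :
  iter k (fun j => ordS (ordS j)) i = ((i + k.*2) %% m)%N :> nat.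
Proof.
elim: k => [|k IHk] /=; first by rewrite addn0 modn_small.
rewrite IHk -[_.+1 in LHS]addn1 modnDml -[(_ %% _).+1%N]addn1 -addnA modnDml.
by congr (_ %% _)%N; lia.
Qed.

(** As [m] is odd, one of [j - i] and [j - i + m] is even, so [j] is reached from
    [i] by steps of two. *)
Lemma odd_iter_ordS2 {m : nat} (i j : 'I_m) : odd m ->
  exists2 k, (k <= m)%N & iter k (fun j => ordS (ordS j)) i = j.
Proof.
move=> odd_m; have im := ltn_ord i; have jm := ltn_ord j.
suff [k [q [km e]]] : exists k q, (k <= m)%N /\ (i + k.*2 = j + q * m)%N.
  by exists k => //; apply: val_inj; rewrite /= iter_ordS2E e addnC modnMDl modn_small.
have [ij|ij] := leqP i j; have [o|o] := boolP (odd (j + i)%N).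
- by exists ((j + m - i)./2)%N, 1%N; lia.
- by exists ((j - i)./2)%N, 0%N; lia.
- by exists ((j + m - i)./2)%N, 1%N; lia.
- by exists ((j + m + m - i)./2)%N, 2%N; lia.
Qed.

Section Resolvent.
Context {R : realType} {m : nat} (c : R) (m3 : (3 <= m)%N).

Let A := 1%:M - c *: centered_mx R m.
Let N := invmx A.

Let unitA : A \in unitmx.
Proof. exact/skew_resolvent_unit/centered_mx_skew. Qed.

Lemma resolvent_col_sum j : \sum_i N i j = 1.
Proof.
pose u : 'rV[R]_m := const_mx 1.
have uL : u *m centered_mx R m = 0.
  apply: trmx_inj; rewrite trmx_mul centered_mx_skew // trmx_const mulNmx.
  by rewrite centered_mx_const // oppr0 trmx0.
have uA : u *m A = u by rewrite mulmxBr mulmx1 -scalemxAr uL scaler0 subr0.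
have uN : u *m N = u by rewrite -{1}uA mulmxK.
have := congr1 (fun w : 'rV_m => w 0 j) uN; rewrite !mxE => <-.
by apply: eq_bigr => i _; rewrite mxE mul1r.
Qed.

(** This is [v A v^T = v v^T] for the transposed [j]-th column [v] of [N], as
    [A v^T] is the [j]-th basis vector. *)
Lemma resolvent_col_sqnorm j : \sum_i N i j ^+ 2 = N j j.
Proof.
have Ax : A *m col j N = delta_mx j 0 by rewrite colE mulmxA mulmxV // mul1mx.
have := skew_resolvent_form (centered_mx R m) c (col j N)^T (centered_mx_skew m3).
rewrite -mulmxA {1}trmxK Ax -colE => /(congr1 (fun B : 'M_1 => B 0 0)) /=.
rewrite row_sqnormE !mxE => ->.
by apply: eq_bigr => i _; rewrite !mxE.
Qed.

(** Cauchy-Schwarz for a column of sum [1] and square norm [N j j], in the form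
    of the nonnegativity of the sum of squares of [N i j - 1/m]. *)
Lemma resolvent_diag_ge j : m%:R^-1 <= N j j.
Proof.
have m_neq0 : m%:R != 0 :> R by rewrite pnatr_eq0; lia.
have : 0 <= \sum_i (N i j - m%:R^-1) ^+ 2.
  by apply: sumr_ge0 => i _; exact: sqr_ge0.
under eq_bigr => i _ do rewrite sqrrB -mulrnAr.
rewrite big_split sumrB /= resolvent_col_sqnorm -mulr_suml resolvent_col_sum.
rewrite sumr_const card_ord -[X in _ + X]mulr_natr expr2 -mulrA mulVf // mulr1.
lra.
Qed.

(** Each [N i j ^+ 2] is at most the square norm [N j j] of its column; for
    [i = j] this says [N j j <= 1], which then bounds the other entries. *)
Lemma resolvent_entry_le1 i j : `|N i j| <= 1.
Proof.
have sq_le k : N k j ^+ 2 <= N j j.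
  rewrite -resolvent_col_sqnorm (bigD1 k) //= lerDl.
  by apply: sumr_ge0 => l _; exact: sqr_ge0.
have Njj : N j j <= 1.
  by have := sq_le j; rewrite expr2 leNgt => sq; apply/negP => gt1; nra.
by rewrite -(@expr_le1 _ 2) // real_normK ?num_real // (le_trans (sq_le i)).
Qed.

(** Row [ordS j] of [A N = 1] equates [c / 2] times the increment over two grid
    points with an entry of [N] minus one of the identity; the two entries are
    bounded by [1], whence the constant [4]. *)
Lemma resolvent_step i j : 0 < c ->
  N j i - 4 / c <= N (ordS (ordS j)) i.
Proof.
move=> c_gt0.
have := congr1 (fun B : 'M_m => B (ordS j) i) (mulmxV unitA).
rewrite /= -/N {1}/A mulmxBl mul1mx -scalemxAl mxE.
rewrite [X in _ + X]mxE [X in _ - X]mxE mul_centered_mxE // ordSK mxE => e.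
have := resolvent_entry_le1 (ordS j) i; rewrite ler_norml => /andP [lo hi].
rewrite lerBlDr -lerBlDl ler_pdivlMr //.
by move: e; case: (_ == _) => /= e; lra.
Qed.

Lemma resolvent_iter_ge i k : 0 < c ->
  m%:R^-1 - k%:R * (4 / c) <= N (iter k (fun j => ordS (ordS j)) i) i.
Proof.
move=> c_gt0; elim: k => [|k IHk]; first by rewrite mul0r subr0 resolvent_diag_ge.
have := resolvent_step i (iter k (fun j => ordS (ordS j)) i) c_gt0.
by rewrite -natr1 /=; lra.
Qed.

(** At most [m] steps of two reach [j] from [i], and they lose at most [4 m / c],
    which the bound on [c] makes no larger than the initial [1/m]. *)
Lemma resolvent_odd_ge0 i j : odd m -> 4 * m%:R ^+ 2 <= c -> 0 <= N j i.
Proof.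
move=> odd_m c_ge; have m_gt0 : 0 < m%:R :> R by rewrite ltr0n; lia.
have c_gt0 : 0 < c by apply: lt_le_trans c_ge; rewrite mulr_gt0 ?exprn_gt0.
have [k km <-] := odd_iter_ordS2 i j odd_m.
apply: le_trans (resolvent_iter_ge i k c_gt0).
rewrite subr_ge0 mulrA ler_pdivrMr // ler_pdivlMl //.
apply: le_trans c_ge; rewrite -(ler_nat R) in km.
by nra.
Qed.

End Resolvent.

(** Multiplied by [A], this is the identity
    [theta (1 + (1 - theta) nu L) + (1 - theta) (1 - theta nu L) = 1]: the mixed
    terms in [L] cancel. *)
Lemma iteration_mx_resolvent {R : realType} {m : nat} (theta nu : R) :
  (3 <= m)%N ->
  theta *: iteration_mx m theta nu
  = invmx (implicit_mx m theta nu) - (1 - theta)%:M.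
Proof.
move=> m3; have unitA := implicit_mx_unit theta nu m3.
apply: (can_inj (mulKmx unitA)).
rewrite -scalemxAr implicit_iteration_mx // mulmxBr mulmxV //.
by apply/matrixP => i j; rewrite mul_mx_scalar !mxE; ring.
Qed.

Lemma iteration_mx_odd_ge0 {R : realType} {m : nat} (theta nu : R) :
  (3 <= m)%N -> odd m -> 0 < theta <= 1 -> 1 - theta <= m%:R^-1 ->
  4 * m%:R ^+ 2 <= theta * nu ->
  forall i j, 0 <= iteration_mx m theta nu i j.
Proof.
move=> m3 odd_m /andP [theta_gt0 theta_le1] theta_ge nu_ge i j.
rewrite -(pmulr_rge0 _ theta_gt0).
have := congr1 (fun B : 'M_m => B i j) (iteration_mx_resolvent theta nu m3).
rewrite !mxE => ->; have [->|_] := eqVneq i j; last first.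
  by rewrite mulr0n subr0 resolvent_odd_ge0.
by rewrite mulr1n subr_ge0 (le_trans theta_ge) // resolvent_diag_ge.
Qed.

(** * The theta-method for the advection equation *)

Theorem theorem1 (R : realType) (a : R) (m : nat) (theta : R)
    (a_gt0 : 0 < a) (m_ge3 : (3 <= m)%N) (theta01 : 0 <= theta <= 1) :
  [/\ forall dt : R, 0 < dt ->
        [/\ 0 < courant m a dt,
            implicit_mx m theta (courant m a dt) \in unitmx &
            forall u v : 'cV[R]_m,
              theta_step a (mesh_width R m) dt theta u v <->
              v = iteration_mx m theta (courant m a dt) *m u],
      ~~ odd m ->
        forall dt : R, 0 < dt ->
          exists i j : 'I_m, iteration_mx m theta (courant m a dt) i j < 0 &
      odd m -> (m%:R - 1) / m%:R <= theta ->
        exists2 dt0 : R, 0 < dt0 &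
          forall dt : R, dt0 <= dt ->
            forall i j : 'I_m, 0 <= iteration_mx m theta (courant m a dt) i j].
Proof.
have m_ge3R : 3 <= m%:R :> R by rewrite (ler_nat R 3).
have m_gt0 : 0 < m%:R :> R by lra.
have courantE dt : courant m a dt = a * dt * m%:R.
  by rewrite /courant /mesh_width div1r invrK mulrA.
have courant_gt0 dt : 0 < dt -> 0 < courant m a dt.
  by move=> dt_gt0; rewrite courantE !mulr_gt0.
split.
- move=> dt dt_gt0; split; [exact: courant_gt0|exact: implicit_mx_unit|].
  by move=> u v; exact: theta_stepP.
- move=> even_m dt dt_gt0; apply: iteration_mx_even_neg => //.
  by rewrite gt_eqF // courant_gt0.
move=> odd_m theta_ge; case/andP: theta01 => theta_ge0 theta_le1.
have theta_gt0 : 0 < theta.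
  by apply: lt_le_trans theta_ge; apply: divr_gt0 => //; lra.
(* As [nu = a dt m], this is the time step at which [theta nu = 4 m^2]. *)
exists (4 * m%:R / (theta * a)); first by rewrite divr_gt0 ?mulr_gt0.
move=> dt; rewrite ler_pdivrMr ?mulr_gt0 // => dt_ge.
apply: iteration_mx_odd_ge0 => //; first by rewrite theta_gt0.
  by move: theta_ge; rewrite mulrBl mul1r divff ?gt_eqF //; lra.
by rewrite courantE expr2; nra.
Qed.
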